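(* Let $f:\mathbb{R}^4\to\mathbb{R}$ be a smooth function with compact support, and let $J_f$ be the almost complex structure on $\mathbb{C}^2\cong\mathbb{R}^4$ defined by $$J_f\frac{\partial}{\partial x_1}=f\frac{\partial}{\partial x_2}+\frac{\partial}{\partial y_1},\quad J_f\frac{\partial}{\partial x_2}=\frac{\partial}{\partial y_2},\quad J_f\frac{\partial}{\partial y_1}=-\frac{\partial}{\partial x_1}-f\frac{\partial}{\partial y_2},\quad J_f\frac{\partial}{\partial y_2}=-\frac{\partial}{\partial x_2}.$$ If $f$ is non-zero (i.e. not identically zero), then $h^-_{J_f}=1$.
   Context: $\mathbb{C}^2\cong\mathbb{R}^4$ has coordinates $(x_1,x_2,y_1,y_2)$, with $z_j=x_j+iy_j$. For an almost complex structure $J$ on a manifold $M$, a smooth real $2$-form $\alpha$ is $J$-anti-invariant if $\alpha(JX,JY)=-\alpha(X,Y)$ for all vector fields $X,Y$. $h^-_J$ denotes the dimension of the real vector space of closed $J$-anti-invariant $2$-forms on $(M,J)$. *)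

(* Defs.v *)
From HB Require Import structures.
From mathcomp Require Import all_boot all_order all_algebra.
From mathcomp Require Import all_classical all_reals all_analysis.
From mathcomp Require Import ring.

Set Implicit Arguments.
Unset Strict Implicit.
Unset Printing Implicit Defensive.
Import Order.TTheory GRing.Theory Num.Theory.
Import numFieldNormedType.Exports.
Local Open Scope classical_set_scope.
Local Open Scope ring_scope.

(* R^4 with coordinates (x1, x2, y1, y2), in this order.  Tangent vectors are
   row vectors in the frame (d/dx1, d/dx2, d/dy1, d/dy2). *)
Notation R4 R := 'rV[R]_4.

Definition ddx1 {R : realType} : R4 R := delta_mx 0 (inord 0).
Definition ddx2 {R : realType} : R4 R := delta_mx 0 (inord 1).
Definition ddy1 {R : realType} : R4 R := delta_mx 0 (inord 2).
Definition ddy2 {R : realType} : R4 R := delta_mx 0 (inord 3).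

Section Smooth.
Variable R : realType.

(* Class C^n. *)
Fixpoint Cn (n : nat) (f : R4 R -> R) : Prop :=
  if n is n'.+1 then
    (forall p, differentiable f p) /\ (forall v, Cn n' ('D_v f))
  else continuous f.

Definition smooth (f : R4 R -> R) := forall n, Cn n f.

Definition compact_support (f : R4 R -> R) :=
  compact (closure [set p | f p != 0]).

Definition smooth_vector_field (X : R4 R -> R4 R) :=
  forall i, smooth (fun p => X p 0 i).

End Smooth.

Section AlmostComplex.
Variable R : realType.

(* An endomorphism A of a tangent space acts on row vectors by u |-> u *m A:
   row i of A is the image of the i-th frame vector. *)
Definition almost_complex (J : R4 R -> 'M[R]_4) :=
  (forall i j, smooth (fun p => J p i j)) /\
  (forall p, J p *m J p = - 1%:M).

Definition Jf (f : R4 R -> R) (p : R4 R) : 'M[R]_4 :=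
  \matrix_(i < 4)
    [:: f p *: ddx2 + ddy1;
        ddy2;
        - ddx1 - f p *: ddy2;
        - ddx2]`_i.

End AlmostComplex.

Section TwoForms.
Variable R : realType.

(* The 2-form \sum_(j < k) (a p j k) dx_j /\ dx_k is represented by the field
   of skew-symmetric matrices of its values on the coordinate frame. *)
Definition two_form (a : R4 R -> 'M[R]_4) :=
  (forall j k, smooth (fun p => a p j k)) /\ (forall p, (a p)^T = - a p).

Definition form_eval (a : R4 R -> 'M[R]_4) (p u v : R4 R) : R :=
  (u *m a p *m v^T) 0 0.

(* (d a)(e_i, e_j, e_k) at p, for e the coordinate frame. *)
Definition ext_deriv (a : R4 R -> 'M[R]_4) (p : R4 R) (i j k : 'I_4) : R :=
  'D_(delta_mx 0 i) (fun q => a q j k) p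
  + 'D_(delta_mx 0 j) (fun q => a q k i) p
  + 'D_(delta_mx 0 k) (fun q => a q i j) p.

Definition closed_form (a : R4 R -> 'M[R]_4) :=
  forall p i j k, ext_deriv a p i j k = 0.

Definition anti_invariant (J : R4 R -> 'M[R]_4) (a : R4 R -> 'M[R]_4) :=
  forall X Y : R4 R -> R4 R, smooth_vector_field X -> smooth_vector_field Y ->
  forall p, form_eval a p (X p *m J p) (Y p *m J p)
            = - form_eval a p (X p) (Y p).

Definition closed_anti_invariant_forms (J : R4 R -> 'M[R]_4) :
    set (R4 R -> 'M[R]_4) :=
  [set a | [/\ two_form a, closed_form a & anti_invariant J a]].

End TwoForms.

(* S is a linear subspace of V with a basis of n elements. *)
Definition has_dim (K : fieldType) (V : lmodType K) (S : set V) (n : nat) :=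
  exists e : 'I_n -> V,
    (forall c : 'I_n -> K, \sum_(i < n) c i *: e i = 0 -> forall i, c i = 0) /\
    S = [set v | exists c : 'I_n -> K, v = \sum_(i < n) c i *: e i].

(* h^-_J = n *)
Definition h_minus_eq (R : realType) (J : R4 R -> 'M[R]_4) (n : nat) :=
  has_dim (closed_anti_invariant_forms J) n.

Section Facts.
Variable R : realType.
Implicit Types (f : R4 R -> R) (p : R4 R).

Lemma Jf_ddx1 f p : ddx1 *m Jf f p = f p *: ddx2 + ddy1.
Proof. by rewrite -rowE rowK inordK. Qed.

Lemma Jf_ddx2 f p : ddx2 *m Jf f p = ddy2.
Proof. by rewrite -rowE rowK inordK. Qed.

Lemma Jf_ddy1 f p : ddy1 *m Jf f p = - ddx1 - f p *: ddy2.
Proof. by rewrite -rowE rowK inordK. Qed.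

Lemma Jf_ddy2 f p : ddy2 *m Jf f p = - ddx2.
Proof. by rewrite -rowE rowK inordK. Qed.

Lemma Cn_cst n (c : R) : Cn n (fun=> c : R).
Proof.
elim: n c => [|n IHn] c /=; first exact: cst_continuous.
split=> [p|v]; first exact: differentiable_cst.
have -> : 'D_v (fun=> c) = (fun=> 0) :> (R4 R -> R).
  by apply/funext => p; exact: derive_cst.
exact: IHn.
Qed.

Lemma Cn_affine n f (c d : R) : Cn n f -> Cn n (fun p => c * f p + d).
Proof.
elim: n f d => [|n IHn] f d /=.
  by move=> cf p; exact: cvgD (cvgM (cvg_cst c) (cf p)) (cvg_cst d).
move=> [df Df]; have E : (fun p => c * f p + d) = c \*: f + cst d by [].
split=> [p|v].
  rewrite E; apply: differentiableD; last exact: differentiable_cst.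
  exact: differentiableZ.
have -> : 'D_v (fun p => c * f p + d) = (fun p => c * 'D_v f p + 0).
  apply/funext => p; have dfp : derivable f p v by exact: diff_derivable.
  rewrite E deriveD; first by rewrite derive_cst deriveZ.
    exact: derivableZ.
  exact: derivable_cst.
exact: IHn.
Qed.

Lemma Jf_almost_complex f : smooth f -> almost_complex (Jf f).
Proof.
move=> sf; split=> [i j n|p].
  pose g (a : R) : 'M[R]_4 := Jf (fun=> a) 0.
  have -> : (fun p => Jf f p i j)
          = (fun p => (g 1 i j - g 0 i j) * f p + g 0 i j).
    apply/funext => p; rewrite /g !mxE.
    by case: i => -[|[|[|[|//]]]] ? /=; rewrite !mxE; ring.
  exact/Cn_affine/sf.
apply/row_matrixP => i; rewrite row_mul rowK.
have -> : row i (- 1%:M) = - delta_mx 0 i :> R4 R by rewrite linearN/= row1.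
have E k (lt : (k < 4)%N) : Ordinal lt = inord k :> 'I_4.
  by apply/val_inj; rewrite /= inordK.
case: i => -[|[|[|[|//]]]] lt /=; rewrite E ?mulmxBl ?mulNmx ?mulmxDl -?scalemxAl.
- by rewrite Jf_ddx2 Jf_ddy1 addrCA addrN addr0.
- by rewrite Jf_ddy2.
- by rewrite Jf_ddx1 Jf_ddy2 scalerN opprK opprD addrAC addNr add0r.
- by rewrite Jf_ddx2.
Qed.

End Facts.

(* Main.v *)
Require Import Defs.
From mathcomp Require Import all_boot all_order all_algebra.
From mathcomp Require Import all_classical all_reals all_analysis.
From mathcomp Require Import ring lra.

(** Anti-invariance under J_f leaves a 2-form two free
    coefficients a = alpha(d/dx1, d/dx2) and b = alpha(d/dx1, d/dy2), with
      alpha = a (dx1 dx2 - dy1 dy2) + b (dx1 dy2 - dx2 dy1) - f a dx1 dy1,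
    which is Im ((b + i a) dz1 dz2) - f a dx1 dy1.  Put w = b + i a and g = f a.
    Closedness is then the system
      (d/dx2 + i d/dy2) w = 0,   (d/dx1 + i d/dy1) w = (d/dx2 - i d/dy2) g.
    For a = 0 it says that b is constant, which gives the line spanned by
    Im (dz1 dz2).  It remains to see that a is identically zero as soon as f is
    non-zero at one point.

    Applying d/dx2 + i d/dy2 to the second equation and using the first one
    kills the left-hand side, because mixed partial derivatives commute
    [derive_comm]; so g is harmonic in (x2, y2) [dbar_potential_harmonic].  As g
    also has compact support, the maximum principle gives g = 0
    [harmonic_compact_eq0].  Hence a = 0 wherever f is non-zero, and w satisfies
    the homogeneous Cauchy-Riemann equations in both complex directions.  On the
    non-empty open set where f is non-zero, all derivatives of a and b vanish;
    these derivatives are again Cauchy-Riemann pairs, so they vanish everywhere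
    by unique continuation [unique_continuation], and a and b are constant.

    Unique continuation is proved by the maximum principle, without power
    series.  If w is a Cauchy-Riemann pair, the logarithm of E = a^2 + b^2 is
    harmonic in each complex direction where E > 0, so E exp(h) has no local
    maximum with E > 0 at a point where h is strictly subharmonic.  The weight
    h(x) = l exp(- m |x - p|^2) is strictly subharmonic away from a small ball
    around p, on which E vanishes.  So the maximum of E exp(h) over a large ball
    lies on its boundary, where h is much smaller than inside; letting l tend to
    infinity forces E = 0 inside. *)

Set Implicit Arguments.
Unset Strict Implicit.
Unset Printing Implicit Defensive.
Import Order.TTheory GRing.Theory Num.Theory.
Import numFieldNormedType.Exports.
Local Open Scope classical_set_scope.
Local Open Scope ring_scope.

(** * Calculus along a direction *)

Lemma dist_le_common (R : realType) (y z y' z' e : R) :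
  y' = z' -> `|y - y'| < e / 2 -> `|z - z'| < e / 2 -> `|z - y| <= e.
Proof.
move=> ->; rewrite !ltr_distlC ler_norml => /andP[? ?] /andP[? ?].
by apply/andP; split; lra.
Qed.

Section Lines.
Variables (R : realType) (V : normedModType R).
Implicit Types (f g : V -> R) (p u v w x : V).

Lemma is_derive_line f x v t d :
  is_derive (t *: v + x) v f d -> is_derive t (1 : R) (fun s => f (s *: v + x)) d.
Proof.
have E : (fun h : R => h^-1 *: (f (h *: v + (t *: v + x)) - f (t *: v + x)))
  = (fun h : R => h^-1 *: (f (((h *: (1 : R) : R) + t) *: v + x) - f (t *: v + x))).
  by apply/funext => h; rewrite scalerDl -addrA [h *: 1]mulr1.
case=> df dE; apply: DeriveDef.
  by move: df; rewrite /derivable /= E.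
by move: dE; rewrite /derive /= E.
Qed.

Lemma is_derive_comp_line f x v d :
  is_derive (0 : R) (1 : R) (fun s => f (s *: v + x)) d -> is_derive x v f d.
Proof.
have E : (fun h : R => h^-1 *: (f (h *: v + x) - f x))
  = (fun h : R => h^-1 *: (f (((h *: (1 : R) : R) + 0) *: v + x) - f (0 *: v + x))).
  by apply/funext => h; rewrite addr0 scale0r add0r [h *: 1]mulr1.
case=> df dE; apply: DeriveDef.
  by move: df; rewrite /derivable /= -E.
by move: dE; rewrite /derive /= -E.
Qed.

Lemma is_derive_translate f w x v d :
  is_derive (w + x) v f d -> is_derive x v (fun y => f (w + y)) d.
Proof.
have E : (fun h : R => h^-1 *: (f (h *: v + (w + x)) - f (w + x)))
  = (fun h : R => h^-1 *: (f (w + (h *: v + x)) - f (w + x))).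
  by apply/funext => h; rewrite addrCA.
case=> df dE; apply: DeriveDef.
  by move: df; rewrite /derivable /= E.
by move: dE; rewrite /derive /= E.
Qed.

Lemma is_derive_expR_comp h x v d :
  is_derive x v h d -> is_derive x v (fun y => expR (h y)) (expR (h x) * d :> R).
Proof.
move=> dh; apply: is_derive_comp_line.
have dl : is_derive (0 : R) (1 : R) (fun s => h (s *: v + x)) d.
  by apply: is_derive_line; rewrite scale0r add0r.
have := @is_derive1_comp _ expR (fun s => h (s *: v + x)) 0 _ _ _ dl.
by move=> /(_ _ (is_derive_expR _)); rewrite scale0r add0r.
Qed.

Lemma mvt_direction f df x v (h : R) : 0 < h ->
  (forall y, is_derive y v f (df y)) ->
  exists2 t, 0 <= t <= h & f (h *: v + x) - f x = h * df (t *: v + x).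
Proof.
move=> h0 dfP.
have dl t : is_derive t (1 : R) (fun s => f (s *: v + x)) (df (t *: v + x)).
  exact: is_derive_line.
have [|t] := MVT h0 (fun t _ => dl t).
  apply/continuous_subspaceT => t.
  exact/differentiable_continuous/derivable1_diffP.
rewrite in_itv /= => /andP[t0 th]; rewrite scale0r add0r subr0 => E.
by exists t; rewrite ?(ltW t0) ?(ltW th)// E mulrC.
Qed.

(** If the second derivative were positive, the first derivative would be
    positive just to the right of the critical point, and the mean value theorem
    would make the function exceed its maximum there. *)
Lemma second_derivative_test_real (F G : R -> R) (d : R) :
  (forall t, is_derive t (1 : R) F (G t)) -> is_derive (0 : R) (1 : R) G d ->
  (\forall t \near (0 : R), F t <= F 0) -> G 0 = 0 /\ d <= 0.
Proof.
move=> dF dG /nbhs_ballP[e /= e0 He].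
have inb t : - e < t < e -> F t <= F 0.
  by move=> /andP[t1 t2]; apply: He; rewrite /ball /= sub0r normrN ltr_norml t1.
have G0 : G 0 = 0.
  have D : is_derive (0 : R) (1 : R) F 0.
    apply: (@derive1_at_max _ F (- e) e).
    - lra.
    - by move=> t _; exact: ex_derive.
    - by rewrite in_itv /=; apply/andP; split; lra.
    - by move=> t; rewrite in_itv /= => /inb.
  by rewrite -(@derive_val _ _ _ _ _ _ _ (dF 0)) derive_val.
split=> //; rewrite leNgt; apply/negP => d0.
have [+ dE] := dG; rewrite /derivable => cG.
have : (fun h : R => h^-1 *: (G ((h *: (1 : R) : R) + 0) - G 0)) @ 0^' --> d.
  by move: cG; rewrite -dE /derive /=.
move=> /cvgrPdist_lt/(_ _ d0); rewrite near_withinE => /nbhs_ballP[r /= r0 Hr].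
have Gpos t : 0 < t -> t < r -> 0 < G t.
  move=> t0 tr; have := Hr t; rewrite /ball /= sub0r normrN gtr0_norm// => /(_ tr).
  move=> /(_ (lt0r_neq0 t0)); rewrite addr0 G0 subr0 [t *: 1]mulr1 => H.
  have : 0 < t^-1 * G t.
    have {H} : d - t^-1 * G t < d := le_lt_trans (ler_norm _) H.
    by rewrite ltrBlDr ltrDl.
  by rewrite pmulr_rgt0// invr_gt0.
pose s := Num.min e r / 2.
have m0 : 0 < Num.min e r by rewrite lt_min e0.
have s0 : 0 < s by rewrite divr_gt0.
have sm : s < Num.min e r by rewrite /s ltr_pdivrMr// mulr_natr mulr2n ltrDl.
have [se sr] : s < e /\ s < r by move: sm; rewrite lt_min => /andP.
have [|t] := MVT s0 (fun t _ => dF t).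
  apply/continuous_subspaceT => t.
  exact/differentiable_continuous/derivable1_diffP.
rewrite in_itv /= => /andP[t0 ts] E.
have eNs : - e < s by apply: lt_trans s0; rewrite oppr_lt0.
have := inb s; rewrite eNs se => /(_ isT).
have : 0 < G t * (s - 0).
  by rewrite mulr_gt0 ?subr0//; apply: Gpos => //; apply: lt_trans sr.
rewrite -E; lra.
Qed.

Lemma second_derivative_test f df d2f x v :
  (forall y, is_derive y v f (df y)) -> is_derive x v df d2f ->
  (\forall y \near x, f y <= f x) -> df x = 0 /\ d2f <= 0.
Proof.
move=> dfP d2 mx.
have := @second_derivative_test_real (fun s => f (s *: v + x)) (fun s => df (s *: v + x)) d2f.
rewrite scale0r add0r; apply.
- by move=> t; exact: is_derive_line.
- by apply: is_derive_line; rewrite scale0r add0r.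
- have c : (fun s : R => s *: v + x) @ (0 : R) --> x.
    rewrite -[in X in _ --> X](add0r x) -(scale0r v).
    apply: cvgD; last exact: cvg_cst.
    exact: scalel_continuous.
  exact: c mx.
Qed.

(** The left-hand side is symmetric in u and v up to the order of its terms: this
    is what makes mixed derivatives commute.  It is the increment along u of
    x |-> f (h v + x) - f x, to which the mean value theorem applies twice. *)
Lemma second_difference f u v p (h : R) :
  (forall w x, derivable f x w) -> (forall x, derivable ('D_u f) x v) -> 0 < h ->
  exists s t : R, [/\ 0 <= s <= h, 0 <= t <= h &
    f (h *: u + h *: v + p) - f (h *: u + p) - f (h *: v + p) + f p =
    h * (h * 'D_v ('D_u f) (s *: u + t *: v + p))].
Proof.
move=> df duf h0.
pose G x := f (h *: v + x) - f x.
have dG x : is_derive x u G ('D_u f (h *: v + x) - 'D_u f x).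
  apply: is_deriveB; last exact/derivableP.
  exact/is_derive_translate/derivableP.
have [s sh Es] := mvt_direction p h0 dG.
have [t th Et] := mvt_direction (s *: u + p) h0 (fun x => derivableP (duf x)).
exists s, t; split=> //.
rewrite Et addrCA addrA /G in Es; rewrite -Es.
by rewrite [h *: v + (_ + _)]addrCA addrA; ring.
Qed.

(** Schwarz's theorem.  The same second difference, divided by h^2, is a value
    of either mixed derivative at some point within O(h) of p; continuity at p
    then identifies the two values at p. *)
Lemma derive_comm_continuous f u v :
  (forall w x, derivable f x w) ->
  (forall x, derivable ('D_u f) x v) -> (forall x, derivable ('D_v f) x u) ->
  continuous ('D_v ('D_u f)) -> continuous ('D_u ('D_v f)) ->
  'D_u ('D_v f) = 'D_v ('D_u f).
Proof.
move=> df duf dvf c1 c2; apply/funext => p; apply/eqP; rewrite -subr_eq0 -normr_le0.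
apply/ler_addgt0Pl => e e0; rewrite addr0.
have e20 : 0 < e / 2 by rewrite divr_gt0.
have /cvgrPdist_lt/(_ _ e20) n1 := c1 p; have /cvgrPdist_lt/(_ _ e20) n2 := c2 p.
have [r /= r0 Hr] := (nbhs_ballP _ _).1 (filterI n1 n2); rewrite {n1 n2}.
(* The 1 keeps N positive when u = v = 0. *)
pose N := `|u| + `|v| + 1.
have N0 : 0 < N by rewrite ltr_wpDl// addr_ge0.
pose h := r / (2 * N).
have h0 : 0 < h by rewrite divr_gt0// mulr_gt0.
have hN : h * N = r / 2 by rewrite /h; field; rewrite gt_eqF.
have inb s t u' v' : 0 <= s <= h -> 0 <= t <= h -> `|u'| + `|v'| + 1 = N ->
  ball p r (s *: u' + t *: v' + p).
  move=> /andP[s0 sh] /andP[t0 th] EN.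
  rewrite -ball_normE /= opprD addrCA subrr addr0 normrN.
  apply: (@le_lt_trans _ _ (h * N)); last by rewrite hN; lra.
  apply: (le_trans (ler_normD _ _)); rewrite !normrZ (ger0_norm s0) (ger0_norm t0).
  rewrite -EN !mulrDr mulr1 ler_wpDr// ?(ltW h0)//.
  by rewrite lerD// ler_wpM2r.
have [s [t [sh th E1]]] := second_difference p df duf h0.
have [t' [s' [th' sh' E2]]] := second_difference p df dvf h0.
rewrite (addrC (h *: v) (h *: u)) (addrAC _ (- f (h *: v + p))) in E2.
have hI (y z : R) : h * (h * y) = h * (h * z) -> y = z.
  by move=> /(mulfI (lt0r_neq0 h0))/(mulfI (lt0r_neq0 h0)).
have {E1 E2} E := hI _ _ (etrans (esym E1) E2).
have [/= H1 _] := Hr _ (inb s t u v sh th erefl).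
have EN : `|v| + `|u| + 1 = N by rewrite [`|v| + _]addrC.
have [_ /= H2] := Hr _ (inb t' s' v u th' sh' EN).
exact: dist_le_common E H1 H2.
Qed.

End Lines.

(** * Cauchy-Riemann pairs *)

Section Smooth.
Variable R : realType.
Implicit Types (f g a b : R4 R -> R) (p q u v x : R4 R).

Lemma smooth_derive f v : smooth f -> smooth ('D_v f).
Proof. by move=> sf n; have [_] := sf n.+1; apply. Qed.

Lemma smooth_is_derive f x v : smooth f -> is_derive x v f ('D_v f x).
Proof. by move=> sf; have [df _] := sf 1; exact/derivableP/diff_derivable. Qed.

Lemma smooth_continuous f : smooth f -> continuous f.
Proof. exact: (@^~ 0). Qed.

Lemma derive0_cst f : smooth f -> (forall x v, 'D_v f x = 0) ->
  forall x y, f x = f y.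
Proof.
move=> sf f0 x y.
have dl (t : R) : is_derive t (1 : R) (fun s => f (s *: (x - y) + y)) 0.
  by apply: is_derive_line; rewrite -(f0 (t *: (x - y) + y) (x - y)); exact: smooth_is_derive.
by have := is_derive_0_is_cst 1 0 dl; rewrite scale1r scale0r add0r subrK.
Qed.

Lemma derive_comm f u v : smooth f -> 'D_u ('D_v f) = 'D_v ('D_u f).
Proof.
move=> sf; have d g w x : smooth g -> derivable g x w.
  by move=> sg; exact/ex_derive/smooth_is_derive.
by apply: derive_comm_continuous => *; do ?apply: d; do ?apply: smooth_continuous;
  do ?apply: smooth_derive.
Qed.

(** Holomorphy of b + i a, and not of a + i b, in the complex variable s + i t
    of the plane p + s u + t v. *)
Definition cauchy_riemann u v a b :=
  forall x, 'D_u b x = 'D_v a x /\ 'D_v b x = - 'D_u a x.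

Lemma smoothN f : smooth f -> smooth (fun y => - f y).
Proof.
move=> sf n; have := Cn_affine (-1) 0 (sf n).
by under eq_fun do rewrite mulN1r addr0.
Qed.

Lemma smooth_deriveN f v x : smooth f -> 'D_v (fun y => - f y) x = - 'D_v f x.
Proof. by move=> sf; apply/deriveN; exact/ex_derive/smooth_is_derive. Qed.

Lemma cauchy_riemann_fun u v a b : cauchy_riemann u v a b ->
  'D_u b = 'D_v a /\ 'D_v b = (fun y => - 'D_u a y).
Proof. by move=> cr; split; apply/funext => y; have [] := cr y. Qed.

Lemma cauchy_riemann_harmonic u v a b : smooth a -> smooth b ->
  cauchy_riemann u v a b -> forall x, 'D_u ('D_u b) x + 'D_v ('D_v b) x = 0.
Proof.
move=> sa sb /cauchy_riemann_fun[-> ->] x.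
rewrite smooth_deriveN; last exact: smooth_derive.
by rewrite (congr1 (@^~ x) (derive_comm u v sa)) subrr.
Qed.

Lemma cauchy_riemann_derive u v w a b : smooth a -> smooth b ->
  cauchy_riemann u v a b -> cauchy_riemann u v ('D_w a) ('D_w b).
Proof.
move=> sa sb /cauchy_riemann_fun[E1 E2] x.
have C f t : smooth f -> 'D_t ('D_w f) x = 'D_w ('D_t f) x.
  by move=> sf; rewrite (congr1 (@^~ x) (derive_comm t w sf)).
split; rewrite (C _ _ sb) (C _ _ sa); first by rewrite E1.
by rewrite E2 smooth_deriveN//; exact: smooth_derive.
Qed.

End Smooth.

(** * Logarithmic convexity and exponential weights *)

(** Turns the scalar actions produced by the derivation rules into products. *)
Lemma scale_mul (R : realType) (x y : R) : x *: y = x * y.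
Proof. by []. Qed.

Section Weights.
Variables (R : realType) (V : normedModType R).
Implicit Types (E h a b : V -> R) (q v x : V).

(** The conclusions are the two derivatives of E exp(h) at its maximum, with the
    positive factor exp(h q) removed. *)
Lemma weighted_second_derivative_test E dE h dh q v (d2E d2h : R) :
  (forall x, is_derive x v E (dE x)) -> is_derive q v dE d2E ->
  (forall x, is_derive x v h (dh x)) -> is_derive q v dh d2h ->
  (\forall x \near q, E x * expR (h x) <= E q * expR (h q)) ->
  dE q + E q * dh q = 0 /\
  d2E + 2 * dE q * dh q + E q * d2h + E q * dh q ^+ 2 <= 0.
Proof.
move=> E1 E2 h1 h2 mx.
have e0 := expR_gt0 (h q).
have F1 x : is_derive x v (fun y => E y * expR (h y)) ((dE x + E x * dh x) * expR (h x)).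
  have := is_deriveM (E1 x) (is_derive_expR_comp (h1 x)).
  by move/is_derive_eq; apply; rewrite !scale_mul ?fctE /=; ring.
have F2 : is_derive q v (fun y => (dE y + E y * dh y) * expR (h y))
  ((d2E + 2 * dE q * dh q + E q * d2h + E q * dh q ^+ 2) * expR (h q)).
  have := is_deriveM (is_deriveD E2 (is_deriveM (E1 q) h2)) (is_derive_expR_comp (h1 q)).
  by move/is_derive_eq; apply; rewrite !scale_mul ?fctE /=; ring.
have [H1 H2] := second_derivative_test F1 F2 mx.
split; last by rewrite pmulr_lle0 in H2.
by move/eqP: H1; rewrite mulf_eq0 (gt_eqF e0) orbF => /eqP.
Qed.

Lemma is_derive_sum_sqr a b v x da db :
  is_derive x v a da -> is_derive x v b db ->
  is_derive x v (fun y => a y ^+ 2 + b y ^+ 2) (2 * (a x * da + b x * db)).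
Proof.
move=> a1 b1; have := is_deriveD (is_deriveX 2 a1) (is_deriveX 2 b1).
by move/is_derive_eq; apply; rewrite !scale_mul ?fctE /=; ring.
Qed.

Lemma is_derive_sum_mul a b c d v x da db dc dd :
  is_derive x v a da -> is_derive x v b db ->
  is_derive x v c dc -> is_derive x v d dd ->
  is_derive x v (fun y => 2 * (a y * c y + b y * d y))
    (2 * (da * c x + a x * dc + db * d x + b x * dd)).
Proof.
move=> a1 b1 c1 d1.
have := is_deriveZ 2 (is_deriveD (is_deriveM a1 c1) (is_deriveM b1 d1)).
by move/is_derive_eq; apply; rewrite !scale_mul ?fctE /=; ring.
Qed.

End Weights.

(** Over the two directions of a complex line the gradient of E is
    (2 (a au + b av), 2 (a av - b au)), of square norm 4 E (au^2 + av^2), while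
    the Laplacian of E is 4 (au^2 + av^2): the logarithm of E is harmonic.  With
    the first-order conditions, E times the sum of the left-hand sides of the two
    second-order ones is therefore E^2 (huu + hvv). *)
Lemma log_subharmonic_algebra (R : realFieldType)
    (a b au av auu avv buu bvv hu hv huu hvv : R) :
  let E := a ^+ 2 + b ^+ 2 in
  let Eu := 2 * (a * au + b * av) in
  let Ev := 2 * (a * av + b * - au) in
  0 < E -> auu + avv = 0 -> buu + bvv = 0 ->
  Eu + E * hu = 0 -> Ev + E * hv = 0 ->
  2 * (au * au + a * auu + av * av + b * buu) + 2 * Eu * hu + E * huu + E * hu ^+ 2 <= 0 ->
  2 * (av * av + a * avv + - au * - au + b * bvv) + 2 * Ev * hv + E * hvv + E * hv ^+ 2 <= 0 ->
  huu + hvv <= 0.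
Proof.
move=> E Eu Ev E0 Ha Hb Hu Hv Huu Hvv.
have {}Ha : avv = - auu by lra.
have {}Hb : bvv = - buu by lra.
have {}Hu : E * hu = - Eu by lra.
have {}Hv : E * hv = - Ev by lra.
have K : E * (2 * (au * au + a * auu + av * av + b * buu) + 2 * Eu * hu + E * huu + E * hu ^+ 2
  + (2 * (av * av + a * avv + - au * - au + b * bvv) + 2 * Ev * hv + E * hvv + E * hv ^+ 2))
  = E ^+ 2 * (huu + hvv).
  have -> : E ^+ 2 * (huu + hvv) = E ^+ 2 * (huu + hvv) + (4 * E * (au ^+ 2 + av ^+ 2) - Eu ^+ 2 - Ev ^+ 2).
    by rewrite /E /Eu /Ev; ring.
  transitivity (4 * E * (au ^+ 2 + av ^+ 2) + 2 * Eu * (E * hu) + 2 * Ev * (E * hv) + E ^+ 2 * (huu + hvv)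
    + (E * hu) ^+ 2 + (E * hv) ^+ 2).
    by rewrite Ha Hb; ring.
  by rewrite Hu Hv; ring.
have : E ^+ 2 * (huu + hvv) <= 0.
  by rewrite -K pmulr_rle0//; lra.
by rewrite pmulr_rle0// exprn_gt0.
Qed.

Section UniqueContinuation.
Variable R : realType.
Implicit Types (a b : R4 R -> R) (p q u v x : R4 R).

(** The maximum principle behind unique continuation: a weight that is strictly
    subharmonic on one complex line through q excludes a local maximum of
    |b + i a|^2 exp(h) at q. *)
Lemma cauchy_riemann_weighted_max u v a b (h hu hv : R4 R -> R) (huu hvv : R) q :
  smooth a -> smooth b -> cauchy_riemann u v a b ->
  (forall x, is_derive x u h (hu x)) -> is_derive q u hu huu ->
  (forall x, is_derive x v h (hv x)) -> is_derive q v hv hvv ->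
  0 < a q ^+ 2 + b q ^+ 2 ->
  (\forall x \near q, (a x ^+ 2 + b x ^+ 2) * expR (h x) <=
                      (a q ^+ 2 + b q ^+ 2) * expR (h q)) ->
  huu + hvv <= 0.
Proof.
move=> sa sb cr h1u h2u h1v h2v E0 mx.
have D c w x : smooth c -> is_derive x w c ('D_w c x) by exact: smooth_is_derive.
have DD c w x : smooth c -> is_derive x w ('D_w c) ('D_w ('D_w c) x).
  by move=> sc; exact/smooth_is_derive/smooth_derive.
have T w hw hww h1 h2 := @weighted_second_derivative_test _ _ _ _ _ hw q w _ hww
  (fun x => is_derive_sum_sqr (D a w x sa) (D b w x sb))
  (is_derive_sum_mul (D a w q sa) (D b w q sb) (DD a w q sa) (DD b w q sb)) h1 h2 mx.
have [Tu Tuu] := T u hu huu h1u h2u.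
have [Tv Tvv] := T v hv hvv h1v h2v.
have [C1 C2] := cr q.
have Hb := cauchy_riemann_harmonic sa sb cr q.
have Ha : 'D_u ('D_u a) q + 'D_v ('D_v a) q = 0.
  (* Multiplying b + i a by - i turns the pair (a, b) into (- b, a). *)
  apply: (cauchy_riemann_harmonic (smoothN sb) sa) => x; have [D1 D2] := cr x.
  by split; rewrite smooth_deriveN// ?D2 opprK.
rewrite C1 C2 in Tu Tuu Tv Tvv.
exact: log_subharmonic_algebra E0 Ha Hb Tu Tv Tuu Tvv.
Qed.

End UniqueContinuation.

Lemma big_ord4 (V : nmodType) (F : 'I_4 -> V) :
  \sum_(i < 4) F i = F (inord 0) + F (inord 1) + F (inord 2) + F (inord 3).
Proof.
rewrite !big_ord_recl big_ord0 addr0 !addrA.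
by congr (F _ + F _ + F _ + F _); apply/val_inj; rewrite /= inordK.
Qed.

Section Weight.
Variable R : realType.
Implicit Types (p q u v x : R4 R) (i : 'I_4).

Definition sqdist p x : R := \sum_(i < 4) (x 0 i - p 0 i) ^+ 2.

Lemma is_derive_coord x v i : is_derive x v (fun y : R4 R => y 0 i) (v 0 i).
Proof.
apply: is_derive_comp_line.
have -> : (fun s : R => (s *: v + x) 0 i) = (fun s : R => s * v 0 i + x 0 i).
  by apply/funext => s; rewrite !mxE.
have := is_deriveD (is_deriveM (is_derive_id (0 : R) (1 : R)) (is_derive_cst (v 0 i : R) (0 : R) (1 : R)))
  (is_derive_cst (x 0 i : R) (0 : R) (1 : R)).
by move/is_derive_eq; apply; rewrite !scale_mul /=; ring.
Qed.

Lemma is_derive_sqdist p x i :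
  is_derive x (delta_mx 0 i) (sqdist p) (2 * (x 0 i - p 0 i)).
Proof.
have D j : is_derive x (delta_mx 0 i) (fun y : R4 R => (y 0 j - p 0 j) ^+ 2)
    (2 * (x 0 j - p 0 j) * (j == i)%:R).
  have := is_deriveX 2 (is_deriveB (is_derive_coord x (delta_mx 0 i) j)
    (is_derive_cst (p 0 j : R) x (delta_mx 0 i))).
  move/is_derive_eq; apply; rewrite !scale_mul ?fctE /= mxE eqxx /=; ring.
have := is_derive_sum D.
rewrite (_ : \sum_(j < 4) (fun y : R4 R => (y 0 j - p 0 j) ^+ 2) = sqdist p); last first.
  by apply/funext => y; rewrite fct_sumE.
move/is_derive_eq; apply.
rewrite (bigD1 i)//= eqxx mulr1 big1 ?addr0// => j /negbTE ->.
by rewrite mulr0.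
Qed.

Lemma continuous_sqdist p : continuous (sqdist p).
Proof.
move=> x; have -> : sqdist p = (fun y => (y 0 (inord 0) - p 0 (inord 0)) ^+ 2 +
  (y 0 (inord 1) - p 0 (inord 1)) ^+ 2 + (y 0 (inord 2) - p 0 (inord 2)) ^+ 2 +
  (y 0 (inord 3) - p 0 (inord 3)) ^+ 2).
  by apply/funext => y; rewrite /sqdist big_ord4.
have c i : (fun y : R4 R => (y 0 i - p 0 i) ^+ 2) @ x --> (x 0 i - p 0 i) ^+ 2.
  have d : (fun y : R4 R => y 0 i - p 0 i) @ x --> x 0 i - p 0 i.
    have cc := @coord_continuous R 1 4 0 i x.
    by apply: (cvgB (f := fun y : R4 R => y 0 i) (g := fun=> p 0 i) cc); exact: cvg_cst.
  exact: (cvgM (d) (d)).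
exact: cvgD (cvgD (cvgD (c _) (c _)) (c _)) (c _).
Qed.

(** The norm of row vectors is the sup norm.  This bound lets the compact sets
    be balls of that norm while the weight stays a smooth function. *)
Lemma norm_sqdist p x : `|x - p| ^+ 2 <= sqdist p x.
Proof.
have s0 : 0 <= sqdist p x by apply: sumr_ge0 => i _; exact: sqr_ge0.
suff : `|x - p| <= Num.sqrt (sqdist p x).
  by move=> /(lerXn2r 2); rewrite !nnegrE normr_ge0 sqrtr_ge0 sqr_sqrtr// => ->.
rewrite [leLHS]/Num.norm /= mx_normrE; apply: bigmax_le; first exact: sqrtr_ge0.
move=> [i j] _ /=; rewrite !mxE -sqrtr_sqr ler_wsqrtr//.
rewrite ord1 /sqdist (bigD1 j)//= lerDl; apply: sumr_ge0 => k _; exact: sqr_ge0.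
Qed.

Definition gaussian_weight p (m l : R) x := l * expR (- m * sqdist p x).

Lemma is_derive_gaussian_weight p (m l : R) x i :
  is_derive x (delta_mx 0 i) (gaussian_weight p m l)
    (- (2 * m) * ((x 0 i - p 0 i) * gaussian_weight p m l x)).
Proof.
have := is_deriveZ l (is_derive_expR_comp (is_deriveZ (- m) (is_derive_sqdist p x i))).
move/is_derive_eq; apply; rewrite /gaussian_weight ?fctE !scale_mul /=. ring.
Qed.

Lemma is_derive2_gaussian_weight p (m l : R) x i :
  is_derive x (delta_mx 0 i)
    (fun y : R4 R => - (2 * m) * ((y 0 i - p 0 i) * gaussian_weight p m l y))
    ((4 * m ^+ 2 * (x 0 i - p 0 i) ^+ 2 - 2 * m) * gaussian_weight p m l x).
Proof.
have := is_deriveZ (- (2 * m)) (is_deriveM (is_deriveB (is_derive_coord x (delta_mx 0 i) i)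
    (is_derive_cst (p 0 i : R) x (delta_mx 0 i))) (is_derive_gaussian_weight p m l x i)).
move/is_derive_eq; apply; rewrite !scale_mul ?fctE /= !mxE !eqxx /=; ring.
Qed.

Lemma continuous_gaussian_weight p (m l : R) : continuous (gaussian_weight p m l).
Proof.
move=> x; have c1 : (fun y => - m * sqdist p y) @ x --> - m * sqdist p x.
  exact: cvgM (cvg_cst (- m)) (@continuous_sqdist p x).
have c2 := cvg_comp _ _ c1 (@continuous_expR R (- m * sqdist p x)).
exact: cvgM (cvg_cst l) c2.
Qed.

End Weight.

(** * Unique continuation *)

Lemma closed_ball_compact_rV (R : realType) n (p : 'rV[R]_n) (r : R) :
  0 < r -> compact (closed_ball p r).
Proof.
move=> r0; apply: bounded_closed_compact; last exact: closed_ball_closed.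
exists (r + `|p|); split; first exact: num_real.
move=> M rM x; rewrite closed_ballE// /closed_ball_ /= => px.
apply: ltW; apply: le_lt_trans rM; rewrite -[x](subrK p).
by apply: (le_trans (ler_normD _ _)); rewrite lerD2r distrC.
Qed.

(** With l = M / (e d), the bound 1 + t <= exp t at t = l d suffices. *)
Lemma expR_scale_dominates (R : realType) (e M d : R) : 0 < e -> e <= M -> 0 < d ->
  exists2 l, 0 < l & M < e * expR (l * d).
Proof.
move=> e0 eM d0; have M0 : 0 < M by apply: lt_le_trans eM.
exists (M / (e * d)); first by rewrite divr_gt0// mulr_gt0.
have -> : M / (e * d) * d = M / e by field; rewrite !gt_eqF.
apply: (@lt_le_trans _ _ (e * (1 + M / e))).
  by rewrite mulrDr mulrCA divff ?gt_eqF// !mulr1 ltrDr.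
by rewrite ler_pM2l// expR_ge1Dx.
Qed.

Section UniqueContinuation.
Variable R : realType.
Implicit Types (a b : R4 R -> R) (p q u v x : R4 R).

(** For a fixed q0 with E q0 > 0, the ball has sup-norm radius r and contains q0,
    and sqdist p is at least r on its boundary but less than r at q0. *)
Lemma unique_continuation a b p : smooth a -> smooth b ->
  cauchy_riemann ddx1 ddy1 a b -> cauchy_riemann ddx2 ddy2 a b ->
  (\forall x \near p, a x = 0 /\ b x = 0) -> forall x, a x = 0 /\ b x = 0.
Proof.
move=> sa sb cr1 cr2 /nbhs_ballP[dl /= dl0 Hdl] q0.
pose E x := a x ^+ 2 + b x ^+ 2.
have E_ge0 x : 0 <= E x by rewrite addr_ge0// sqr_ge0.
suff : E q0 <= 0.
  move=> E0; have : E q0 == 0 by rewrite eq_le E0 E_ge0.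
  by rewrite /E paddr_eq0 ?sqr_ge0// !sqrf_eq0 => /andP[/eqP-> /eqP->].
rewrite leNgt; apply/negP => E0.
have cE : continuous E.
  move=> x; have ca := smooth_continuous sa (x := x).
  have cb := smooth_continuous sb (x := x).
  exact: cvgD (cvgM (ca) (ca)) (cvgM (cb) (cb)).
have far x : 0 < E x -> dl ^+ 2 <= sqdist p x.
  move=> Ex; apply: le_trans (norm_sqdist p x).
  rewrite lerXn2r ?nnegrE// ?(ltW dl0)// leNgt; apply/negP => xp.
  have [] : a x = 0 /\ b x = 0 by apply: Hdl; rewrite -ball_normE /= distrC.
  by move=> ax bx; move: Ex; rewrite /E ax bx expr0n addr0 ltxx.
pose r := sqdist p q0 + `|q0 - p| + 1.
have s0 : 0 <= sqdist p q0 by apply: sumr_ge0 => i _; exact: sqr_ge0.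
have r1 : 1 <= r by rewrite lerDr addr_ge0.
have r0 : 0 < r by apply: lt_le_trans r1.
have sr : sqdist p q0 < r by rewrite /r -addrA ltrDl ltr_wpDl.
have inK x : closed_ball p r x = (`|x - p| <= r) :> Prop.
  by rewrite closed_ballE// /closed_ball_ /= distrC.
have q0K : closed_ball p r q0 by rewrite inK /r addrAC lerDr addr_ge0.
have cK := closed_ball_compact_rV (p := p) r0.
have K0 : closed_ball p r !=set0 by exists q0.
have [q1 _ M1] := EVT_max_rV K0 cK (continuous_subspaceT cE).
have leM x : closed_ball p r x -> E x <= E q1 by move=> ?; apply/M1/mem_set.
(* The Laplacian of exp (- m s), s = sqdist p, is (4 m^2 s - 8 m) exp (- m s) in
   dimension 4, so any constant above 2 in place of 3 works for s >= dl^2. *)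
pose m := 3 / dl ^+ 2.
have m0 : 0 < m by rewrite divr_gt0// exprn_gt0.
pose d := expR (- m * sqdist p q0) - expR (- m * r).
have d0 : 0 < d by rewrite subr_gt0 ltr_expR !mulNr ltrN2 ltr_pM2l.
have [l l0 Hl] := expR_scale_dominates E0 (leM _ q0K) d0.
pose h := gaussian_weight p m l.
pose Psi x := E x * expR (h x).
have cPsi : continuous Psi.
  move=> x; have ch := @continuous_gaussian_weight R p m l x.
  have ce := cvg_comp _ _ ch (@continuous_expR R (h x)).
  exact: cvgM (cE x) ce.
have [q qK Mq] := EVT_max_rV K0 cK (continuous_subspaceT cPsi).
have {}qK : closed_ball p r q by rewrite inE in qK.
have Psi_le x : closed_ball p r x -> Psi x <= Psi q by move=> ?; apply/Mq/mem_set.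
have Eq : 0 < E q.
  have : 0 < Psi q by apply: lt_le_trans (Psi_le _ q0K); rewrite mulr_gt0// expR_gt0.
  by rewrite pmulr_lgt0// expR_gt0.
have [qr|qr] := ltP `|q - p| r.
- (* Interior maximum: the weight has a positive Laplacian at q. *)
  have mx : \forall x \near q, Psi x <= Psi q.
    have : nbhs q (closed_ball p r)°.
      rewrite interior_closed_ballE//; apply: open_nbhs_nbhs; split; first exact: ball_open.
      by rewrite -ball_normE /= distrC.
    by apply: filterS => x /interior_subset; exact: Psi_le.
  have T u v i j : u = delta_mx 0 i -> v = delta_mx 0 j -> cauchy_riemann u v a b ->
      (4 * m ^+ 2 * (q 0 i - p 0 i) ^+ 2 - 2 * m) * h q +
      (4 * m ^+ 2 * (q 0 j - p 0 j) ^+ 2 - 2 * m) * h q <= 0.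
    move=> -> -> cr; apply: (cauchy_riemann_weighted_max sa sb cr _ _ _ _ Eq mx).
    + by move=> x; exact: is_derive_gaussian_weight.
    + exact: is_derive2_gaussian_weight.
    + by move=> x; exact: is_derive_gaussian_weight.
    + exact: is_derive2_gaussian_weight.
  have := lerD (T _ _ _ _ erefl erefl cr1) (T _ _ _ _ erefl erefl cr2).
  rewrite addr0 -!mulrDl leNgt => /negP; apply.
  rewrite mulr_gt0//; last by rewrite /h /gaussian_weight mulr_gt0// expR_gt0.
  have -> : forall A B C D : R, 4 * m ^+ 2 * A - 2 * m + (4 * m ^+ 2 * C - 2 * m) +
     (4 * m ^+ 2 * B - 2 * m + (4 * m ^+ 2 * D - 2 * m)) = 4 * m * (m * (A + B + C + D) - 2).
    by move=> *; ring.
  rewrite -(big_ord4 (fun i => (q 0 i - p 0 i) ^+ 2)) -/(sqdist p q).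
  rewrite mulr_gt0//; first by rewrite mulr_gt0.
  have : m * dl ^+ 2 <= m * sqdist p q by rewrite ler_pM2l// far.
  have -> : m * dl ^+ 2 = 3 by rewrite /m divfK// expf_neq0// gt_eqF.
  move=> ?; lra.
- (* Boundary maximum: the choice of l makes the value at q0 larger. *)
  have rs : r <= sqdist p q.
    (* |q - p| <= |q - p|^2 because |q - p| >= r >= 1. *)
    apply: le_trans (norm_sqdist p q); apply: (le_trans qr).
    by rewrite expr2 ler_peMl// (le_trans r1 qr).
  have hq : h q <= l * expR (- m * r).
    by rewrite /h /gaussian_weight ler_pM2l// ler_expR !mulNr lerN2 ler_pM2l.
  have : Psi q0 <= E q1 * expR (l * expR (- m * r)).
    apply: (le_trans (Psi_le _ q0K)); apply: ler_pM => //.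
    - exact: leM.
    - by rewrite ler_expR.
  rewrite leNgt => /negP; apply.
  rewrite /Psi; have -> : h q0 = l * d + l * expR (- m * r).
    by rewrite /h /gaussian_weight /d -mulrDr subrK.
  by rewrite expRD mulrA ltr_pM2r// expR_gt0.
Qed.

End UniqueContinuation.

(** * The closedness equations *)

Lemma ord4_ind (P : 'I_4 -> Prop) :
  P (inord 0) -> P (inord 1) -> P (inord 2) -> P (inord 3) -> forall i, P i.
Proof.
by move=> P0 P1 P2 P3 [[|[|[|[|//]]]] lt];
  [move: P0|move: P1|move: P2|move: P3]; congr P; apply/val_inj; rewrite /= inordK.
Qed.

Section Liouville.
Variable R : realType.
Implicit Types (a b f g : R4 R -> R) (p q u v x : R4 R).

(** At a maximum q of g exp(e y_i^2) with g q > 0, the two second-order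
    conditions add up to 2 e g (1 - 2 e q_i^2) <= 0, which fails as soon as
    2 e q_i^2 < 1.  The factor is needed because the second derivatives of g
    itself may both vanish at a maximum. *)
Lemma harmonic_compact_le0 g (K : set (R4 R)) (i : 'I_4) v :
  smooth g -> compact K -> (forall x, g x != 0 -> K x) -> v 0 i = 0 ->
  (forall x, 'D_(delta_mx 0 i) ('D_(delta_mx 0 i) g) x + 'D_v ('D_v g) x = 0) ->
  forall x, g x <= 0.
Proof.
move=> sg cK gK vi hg p; rewrite leNgt; apply/negP => gp.
have Kp : K p by apply: gK; rewrite gt_eqF.
have K0 : K !=set0 by exists p.
have csq : continuous (fun y : R4 R => y 0 i ^+ 2).
  by move=> x; have cc := @coord_continuous R 1 4 0 i x; exact: cvgM (cc) (cc).
have [q1 _ M1] := EVT_max_rV K0 cK (continuous_subspaceT csq).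
pose c := q1 0 i ^+ 2 + 1.
have c0 : 0 < c by rewrite ltr_wpDl// sqr_ge0.
(* Here c exceeds every y_i^2 on K. *)
pose e := (2 * c)^-1.
have e0 : 0 < e by rewrite invr_gt0 mulr_gt0.
pose h (y : R4 R) := e * y 0 i ^+ 2.
have ch : continuous h by move=> x; exact: cvgM (cvg_cst e) (csq x).
pose Psi x := g x * expR (h x).
have cPsi : continuous Psi.
  move=> x; have ce := cvg_comp _ _ (ch x) (@continuous_expR R (h x)).
  exact: cvgM (smooth_continuous sg (x := x)) ce.
have [q qK Mq] := EVT_max_rV K0 cK (continuous_subspaceT cPsi).
have Psi_q : 0 < Psi q.
  by apply: lt_le_trans (Mq _ (mem_set Kp)); rewrite mulr_gt0// expR_gt0.
have gq : 0 < g q by move: Psi_q; rewrite pmulr_lgt0// expR_gt0.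
have max_q x : Psi x <= Psi q.
  have [gx|gx] := eqVneq (g x) 0.
    by rewrite /Psi gx mul0r ltW.
  by apply: Mq; apply/mem_set/gK.
have mx : \forall x \near q, Psi x <= Psi q by exact: filterE.
have D w x : is_derive x w g ('D_w g x) by exact: smooth_is_derive.
have DD w : is_derive q w ('D_w g) ('D_w ('D_w g) q) by exact/smooth_is_derive/smooth_derive.
have h1 w x : is_derive x w h (2 * e * w 0 i * x 0 i).
  have := is_deriveZ e (is_deriveX 2 (is_derive_coord x w i)).
  by move/is_derive_eq; apply; rewrite !scale_mul ?fctE /=; ring.
have h2 w : is_derive q w (fun x => 2 * e * w 0 i * x 0 i) (2 * e * w 0 i ^+ 2).
  have := is_deriveZ (2 * e * w 0 i) (is_derive_coord q w i).
  by move/is_derive_eq; apply; rewrite !scale_mul ?fctE /=; ring.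
have [_ Tv] := weighted_second_derivative_test (D v) (DD v) (h1 v) (h2 v) mx.
have [Ti Tii] := weighted_second_derivative_test (D _) (DD _)
  (h1 (delta_mx 0 i)) (h2 _) mx.
move: (hg q) Tv Ti Tii; rewrite vi mxE !eqxx /=.
move: ('D_v ('D_v g) q) ('D_v g q) => gvv gv.
move: ('D_(delta_mx 0 i) ('D_(delta_mx 0 i) g) q) ('D_(delta_mx 0 i) g q) => gii gi.
have qc : q 0 i ^+ 2 < c by rewrite /c ltr_pwDr//; apply: M1.
have : e * q 0 i ^+ 2 < 1 / 2.
  have -> : 1 / 2 = e * c by rewrite /e; field; rewrite gt_eqF.
  by rewrite ltr_pM2l.
move: (q 0 i) (g q) gq e0; clear => y G G0 e0 ey H Tv Ti Tii.
have {}Ti : gi = - (2 * e * G * y) by lra.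
have : 0 < (2 * e) * G * (1 - 2 * (e * y ^+ 2)).
  by rewrite mulr_gt0 ?mulr_gt0//; lra.
have -> : (2 * e) * G * (1 - 2 * (e * y ^+ 2)) =
  (gii + 2 * gi * (2 * e * 1 * y) + G * (2 * e * 1 ^+ 2) + G * (2 * e * 1 * y) ^+ 2)
  + (gvv + 2 * gv * (2 * e * 0 * y) + G * (2 * e * 0 ^+ 2) + G * (2 * e * 0 * y) ^+ 2) - (gii + gvv).
  by rewrite Ti; ring.
lra.
Qed.

Lemma harmonic_compact_eq0 g (K : set (R4 R)) (i : 'I_4) v :
  smooth g -> compact K -> (forall x, g x != 0 -> K x) -> v 0 i = 0 ->
  (forall x, 'D_(delta_mx 0 i) ('D_(delta_mx 0 i) g) x + 'D_v ('D_v g) x = 0) ->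
  forall x, g x = 0.
Proof.
move=> sg cK gK vi hg x; apply/eqP; rewrite eq_le.
rewrite (harmonic_compact_le0 sg cK gK vi hg) /= -oppr_le0.
apply: (harmonic_compact_le0 (smoothN sg) cK _ vi) => [y|y]; first by rewrite oppr_eq0; exact: gK.
have N w : 'D_w (fun y => - g y) = (fun y => - 'D_w g y).
  by apply/funext => z; exact: smooth_deriveN.
rewrite !N !smooth_deriveN; try exact: smooth_derive.
by rewrite -opprD hg oppr0.
Qed.

Lemma derive_coord0 f x : smooth f ->
  (forall i, 'D_(delta_mx 0 i) f x = 0) -> forall v, 'D_v f x = 0.
Proof.
move=> sf f0 v; have [df _] := sf 1.
rewrite deriveE// (row_sum_delta v) linear_sum big1// => i _.
by rewrite linearZ /= -deriveE// f0 scaler0.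
Qed.

(** With w = b + i a the hypotheses are dbar_2 w = 0 and dbar_1 w = d_2 g, for
    dbar_k = D_uk + i D_vk and d_2 = D_u2 - i D_v2; then
    dbar_2 (d_2 g) = dbar_1 (dbar_2 w) = 0, and dbar_2 d_2 is the
    Laplacian in the directions u2, v2. *)
Lemma dbar_potential_harmonic u1 v1 u2 v2 a b g : smooth a -> smooth b ->
  cauchy_riemann u2 v2 a b ->
  (forall x, 'D_u2 g x = 'D_u1 b x - 'D_v1 a x) ->
  (forall x, 'D_v2 g x = - 'D_u1 a x - 'D_v1 b x) ->
  forall x, 'D_u2 ('D_u2 g) x + 'D_v2 ('D_v2 g) x = 0.
Proof.
move=> sa sb /cauchy_riemann_fun[E1 E2] /funext E3 /funext E4 x.
have D f v w y : smooth f -> derivable ('D_w f) y v.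
  by move=> s; exact/ex_derive/smooth_is_derive/smooth_derive.
have C f v w : smooth f -> 'D_v ('D_w f) x = 'D_w ('D_v f) x.
  by move=> s; rewrite (congr1 (@^~ x) (derive_comm v w s)).
have D2 : 'D_u2 ('D_u2 g) x = 'D_u1 ('D_v2 a) x - 'D_v1 ('D_u2 a) x.
  rewrite E3 deriveB; [|exact: D|exact: D].
  by rewrite (C b u2 u1 sb) E1 (C a u2 v1 sa).
have D4 : 'D_v2 ('D_v2 g) x = - 'D_u1 ('D_v2 a) x + 'D_v1 ('D_u2 a) x.
  rewrite E4 deriveB; [|exact/derivableN/D|exact: D].
  rewrite deriveN; last exact: D.
  rewrite (C a v2 u1 sa) (C b v2 v1 sb) E2 smooth_deriveN ?opprK//.
  exact: smooth_derive.
by rewrite D2 D4 addrACA subrr addNr addr0.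
Qed.

(** Compact support of f forces the inhomogeneous term g to vanish.  Unique
    continuation is applied to the derivatives of a and b rather than to the
    pair itself, since b is only locally constant where f is non-zero. *)
Lemma dbar_system_rigidity a b g f : smooth a -> smooth b -> smooth g ->
  (forall x, g x = f x * a x) -> continuous f -> compact_support f ->
  (exists p, f p <> 0) ->
  (forall x, 'D_ddx2 b x = 'D_ddy2 a x) ->
  (forall x, 'D_ddy2 b x = - 'D_ddx2 a x) ->
  (forall x, 'D_ddx2 g x = 'D_ddx1 b x - 'D_ddy1 a x) ->
  (forall x, 'D_ddy2 g x = - 'D_ddx1 a x - 'D_ddy1 b x) ->
  (forall x, a x = 0) /\ (forall x y, b x = b y).
Proof.
move=> sa sb sg gE cf fK [p fp] e1 e2 e3 e4.
have cr2 : cauchy_riemann ddx2 ddy2 a b by [].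
have hg := dbar_potential_harmonic sa sb cr2 e3 e4.
have g0 : forall x, g x = 0.
  apply: (harmonic_compact_eq0 sg fK _ _ hg) => [x gx|].
    apply: subset_closure; apply: contra_neq gx => fx.
    by rewrite gE fx mul0r.
  rewrite mxE eqxx /=; case: eqP => // /(congr1 val); rewrite /= !inordK//.
have Dg v x : 'D_v g x = 0.
  have -> : g = cst 0 by exact/funext.
  exact: derive_cst.
have cr1 : cauchy_riemann ddx1 ddy1 a b.
  move=> x; have := e3 x; have := e4 x; rewrite !Dg => /eqP + /eqP.
  rewrite eq_sym subr_eq0 => /eqP <-; rewrite eq_sym subr_eq0 => /eqP <-.
  by [].
have U0 x : f x <> 0 -> \forall y \near x, f y != 0.
  by move=> /eqP fx; exact: cvgr_neq0 (cf x) fx.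
have Da0 v x : f x <> 0 -> 'D_v a x = 0.
  move=> fx; rewrite -(derive_cst (0 : R) x v); apply: near_eq_derive.
  apply: filterS (U0 x fx) => y fy; apply/eqP.
  by have /eqP := gE y; rewrite g0 eq_sym mulf_eq0 (negbTE fy).
have Db0 x : f x <> 0 -> forall v, 'D_v b x = 0.
  move=> fx; apply: derive_coord0 => //; apply: ord4_ind.
  - by rewrite (cr1 x).1 Da0.
  - by rewrite (cr2 x).1 Da0.
  - by rewrite (cr1 x).2 Da0// oppr0.
  - by rewrite (cr2 x).2 Da0// oppr0.
have all0 v x : 'D_v a x = 0 /\ 'D_v b x = 0.
  have near0 : \forall y \near p, 'D_v a y = 0 /\ 'D_v b y = 0.
    by apply: filterS (U0 p fp) => y /eqP fy; split; [exact: Da0|exact: Db0].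
  exact: (unique_continuation (smooth_derive v sa) (smooth_derive v sb)
    (cauchy_riemann_derive v sa sb cr1) (cauchy_riemann_derive v sa sb cr2) near0 x).
have a_cst := derive0_cst sa (fun x v => (all0 v x).1).
split=> [x|]; last exact: derive0_cst sb (fun x v => (all0 v x).2).
rewrite (a_cst x p); apply/eqP.
by have /eqP := gE p; rewrite g0 eq_sym mulf_eq0 (negbTE (introN eqP fp)).
Qed.

End Liouville.

(** * Anti-invariant 2-forms *)

Section Forms.
Variable R : realType.
Implicit Types (f : R4 R -> R) (a : R4 R -> 'M[R]_4) (p u v w : R4 R).

Lemma form_eval_coord a p i j :
  form_eval a p (delta_mx 0 i) (delta_mx 0 j) = a p i j.
Proof. by rewrite /form_eval -rowE trmx_delta -colE !mxE. Qed.

Lemma form_evalDl a p u v w : form_eval a p (u + v) w = form_eval a p u w + form_eval a p v w.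
Proof. by rewrite /form_eval !mulmxDl mxE. Qed.

Lemma form_evalZl a p c u w : form_eval a p (c *: u) w = c * form_eval a p u w.
Proof. by rewrite /form_eval -!scalemxAl mxE. Qed.

Lemma form_evalNl a p u w : form_eval a p (- u) w = - form_eval a p u w.
Proof. by rewrite /form_eval !mulNmx mxE. Qed.

Lemma form_evalDr a p u v w : form_eval a p w (u + v) = form_eval a p w u + form_eval a p w v.
Proof. by rewrite /form_eval linearD mulmxDr mxE. Qed.

Lemma form_evalZr a p c u w : form_eval a p w (c *: u) = c * form_eval a p w u.
Proof. by rewrite /form_eval linearZ -scalemxAr mxE. Qed.

Lemma form_evalNr a p u w : form_eval a p w (- u) = - form_eval a p w u.
Proof. by rewrite /form_eval linearN mulmxN mxE. Qed.

Definition form_evalE := (form_evalDl, form_evalZl, form_evalNl, form_evalDr,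
  form_evalZr, form_evalNr, form_eval_coord).

Lemma anti_invariant_const J a p u v : anti_invariant J a ->
  form_eval a p (u *m J p) (v *m J p) = - form_eval a p u v.
Proof.
move=> aJ; apply: (aJ (fun=> u) (fun=> v)) => i n; exact: Cn_cst.
Qed.

Lemma two_form_skew a p i j : two_form a -> a p j i = - a p i j.
Proof. by case=> _ /(_ p)/matrixP/(_ i j); rewrite !mxE. Qed.

Lemma two_form_diag a p i : two_form a -> a p i i = 0.
Proof. move=> ta; have := two_form_skew p i i ta; lra. Qed.

(** Anti-invariance is imposed on the four pairs (d/dx2, d/dy2), (d/dx1, d/dx2),
    (d/dx1, d/dy2) and (d/dx1, d/dy1), each of which determines one coefficient. *)
Lemma anti_invariant_Jf_coord f a p : two_form a -> anti_invariant (Jf f) a ->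
  [/\ a p (inord 1) (inord 3) = 0,
      a p (inord 2) (inord 3) = - a p (inord 0) (inord 1),
      a p (inord 1) (inord 2) = - a p (inord 0) (inord 3) &
      a p (inord 0) (inord 2) = - (f p * a p (inord 0) (inord 1))].
Proof.
move=> ta aJ; have A u v := anti_invariant_const p u v aJ.
have := A ddx1 ddy1; have := A ddx1 ddy2; have := A ddx1 ddx2; have := A ddx2 ddy2.
rewrite !(Jf_ddx1, Jf_ddx2, Jf_ddy1, Jf_ddy2) /ddx1 /ddx2 /ddy1 /ddy2 !form_evalE.
have S i j := two_form_skew p i j ta.
rewrite ?(two_form_diag _ _ ta) ?(S (inord 0) (inord 1)) ?(S (inord 0) (inord 2)) ?(S (inord 0) (inord 3))
  ?(S (inord 1) (inord 2)) ?(S (inord 1) (inord 3)) ?(S (inord 2) (inord 3)).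
move: (a p (inord 0) (inord 1)) (a p (inord 0) (inord 2)) (a p (inord 0) (inord 3))
  (a p (inord 1) (inord 2)) (a p (inord 1) (inord 3)) (a p (inord 2) (inord 3)) (f p).
clear => a01 a02 a03 a12 a13 a23 F H1 H2 H3 H4.
have Z : a13 = 0 by lra.
rewrite Z in H1 H2 H3 H4 *.
have E1 : a23 = - a01 by lra.
have E2 : a12 = - a03 by lra.
split=> //; rewrite E1 in H4; lra.
Qed.

(** Im (dz1 dz2) = dx1 dy2 - dx2 dy1. *)
Definition Omega : 'M[R]_4 := \matrix_(i < 4, j < 4)
  (nth [::] [:: [:: 0; 0; 0; 1]; [:: 0; 0; -1; 0]; [:: 0; 1; 0; 0];
                [:: -1; 0; 0; 0]] i)`_j.

Lemma form_eval_Omega (c : R) p u v :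
  form_eval (fun=> c *: Omega) p u v =
  c * (u 0 (inord 0) * v 0 (inord 3) - u 0 (inord 3) * v 0 (inord 0)
     - (u 0 (inord 1) * v 0 (inord 2) - u 0 (inord 2) * v 0 (inord 1))).
Proof.
rewrite /form_eval mxE big_ord4 !mxE !big_ord4 !mxE !inordK//=; ring.
Qed.

Lemma mulmx_Jf f p u :
  [/\ (u *m Jf f p) 0 (inord 0) = - u 0 (inord 2),
      (u *m Jf f p) 0 (inord 1) = f p * u 0 (inord 0) - u 0 (inord 3),
      (u *m Jf f p) 0 (inord 2) = u 0 (inord 0) &
      (u *m Jf f p) 0 (inord 3) = u 0 (inord 1) - f p * u 0 (inord 2)].
Proof.
have E i j (hi : (i < 4)%N) (hj : (j < 4)%N) : (inord i == inord j :> 'I_4) = (i == j).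
  by rewrite -val_eqE /= !inordK.
by split; rewrite mxE big_ord4 !mxE !inordK//= !mxE !E//= ?eqxx; ring.
Qed.

Lemma Omega_closed_anti_invariant f (c : R) :
  closed_anti_invariant_forms (Jf f) (fun=> c *: Omega).
Proof.
split.
- split=> [j k n|p]; first exact: Cn_cst.
  apply/matrixP; apply: ord4_ind; apply: ord4_ind; rewrite !mxE !inordK//=; ring.
- by move=> p i j k; rewrite /ext_deriv !derive_cst !addr0.
- move=> X Y _ _ p; rewrite !form_eval_Omega.
  have [-> -> -> ->] := mulmx_Jf f p (X p); have [-> -> -> ->] := mulmx_Jf f p (Y p).
  ring.
Qed.

Lemma closed_anti_invariant_Jf f a : continuous f -> compact_support f ->
  (exists p, f p <> 0) -> closed_anti_invariant_forms (Jf f) a ->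
  exists c : R, a = (fun=> c *: Omega).
Proof.
move=> cf sf nf [ta ca aJ].
have C p := anti_invariant_Jf_coord p ta aJ.
have S i j p := two_form_skew p i j ta.
pose A p := a p (inord 0) (inord 1); pose B p := a p (inord 0) (inord 3).
pose G p := - a p (inord 0) (inord 2).
have sA : smooth A by exact: ta.1.
have sB : smooth B by exact: ta.1.
have sG : smooth G by apply: smoothN; exact: ta.1.
have F13 : (fun q => a q (inord 1) (inord 3)) = cst 0 by apply/funext => q; have [] := C q.
have F31 : (fun q => a q (inord 3) (inord 1)) = cst 0.
  by apply/funext => q; rewrite S; have [-> _ _ _] := C q; rewrite oppr0.
have F23 : (fun q => a q (inord 2) (inord 3)) = (fun q => - A q) by apply/funext => q; have [] := C q.
have F12 : (fun q => a q (inord 1) (inord 2)) = (fun q => - B q) by apply/funext => q; have [] := C q.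
have F20 : (fun q => a q (inord 2) (inord 0)) = G by apply/funext => q; rewrite S.
have F02 : (fun q => a q (inord 0) (inord 2)) = (fun q => - G q) by apply/funext => q; rewrite opprK.
have F30 : (fun q => a q (inord 3) (inord 0)) = (fun q => - B q) by apply/funext => q; rewrite S.
have D0 v p : 'D_v (cst 0 : R4 R -> R) p = 0 by exact: derive_cst.
have N := smooth_deriveN.
have [A0 Bc] : (forall x, A x = 0) /\ (forall x y, B x = B y).
  apply: (dbar_system_rigidity sA sB sG _ cf sf nf) => x.
  - by rewrite /G; have [_ _ _ ->] := C x; rewrite opprK.
  - have := ca x (inord 0) (inord 1) (inord 3).
    rewrite /ext_deriv F13 F30 D0 (N _ B)// add0r addrC => /eqP; rewrite subr_eq0 => /eqP E.
    exact: esym E.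
  - have := ca x (inord 1) (inord 2) (inord 3).
    rewrite /ext_deriv F23 F31 F12 D0 (N _ A)// (N _ B)// addr0 => /eqP; rewrite subr_eq0 => /eqP E.
    exact: esym E.
  - have := ca x (inord 0) (inord 1) (inord 2).
    rewrite /ext_deriv F12 F20 (N _ B)//.
    by move: ('D_ddx1 B x) => z; lra.
  - have := ca x (inord 0) (inord 2) (inord 3).
    rewrite /ext_deriv F23 F30 F02 (N _ A)// (N _ B)// (N _ G)//.
    lra.
exists (B 0); apply/funext => p; apply/matrixP.
have [E1 E2 E3 E4] := C p; have := A0 p; have := Bc p 0.
rewrite /A /B => EB EA.
apply: ord4_ind; apply: ord4_ind; rewrite !mxE !inordK//= ?mulr0 ?mulr1 ?mulrN1
  ?(two_form_diag _ _ ta)// ?E1 ?E2 ?E3 ?E4 ?EA ?mulr0 ?oppr0 ?EB//;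
  by rewrite S ?E1 ?E2 ?E3 ?E4 ?EA ?mulr0 ?oppr0 ?opprK ?EB.
Qed.

End Forms.

Theorem theorem3p8 (R : realType) (f : 'rV[R]_4 -> R)
    (f_smooth : smooth f) (f_supp : compact_support f)
    (f_neq0 : exists p, f p <> 0%R) :
  h_minus_eq (Jf f) 1.
Proof.
exists (fun _ _ => Omega R); split=> [c|].
  rewrite big_ord1 => c0 i.
  have : (c ord0 *: Omega R) (inord 0) (inord 3) = 0.
    by rewrite -[_ *: _]/((c ord0 *: (fun=> Omega R)) (0 : 'rV[R]_4)) c0 mxE.
  by rewrite !mxE !inordK//= mulr1 (ord1 i).
apply/seteqP; split=> [a Sa|_ [c ->]].
  have [c ->] := closed_anti_invariant_Jf (smooth_continuous f_smooth) f_supp f_neq0 Sa.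
  by exists (fun=> c); rewrite big_ord1.
by rewrite big_ord1; exact: Omega_closed_anti_invariant.
Qed.
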